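(* Let $k$ be an algebraically closed field of characteristic $p>3$. For $\alpha\in k\cup\{\infty\}$, consider the foliation $\mathcal{F}^4_\alpha$ on $\mathbf{P}^2_k$ defined by the kernel of the form $$(y^3-z^3)(yz-\alpha x^2)\,dx+(z^3-x^3)(xz-\alpha y^2)\,dy+(x^3-y^3)(xy-\alpha z^2)\,dz$$ (for $\alpha=\infty$, by the kernel of $(y^3-z^3)x^2\,dx+(z^3-x^3)y^2\,dy+(x^3-y^3)z^2\,dz$). Then: - for $p\equiv2\pmod 3$, $\mathcal{F}^4_\alpha$ has a rational first integral for every $\alpha\in k\cup\{\infty\}$; - for $p\equiv1\pmod 3$, $\mathcal{F}^4_\alpha$ has a rational first integral if and only if $\alpha\in\mathbf{F}_p\cup\{\infty\}$.
   Context: A rational first integral of a foliation defined by a $1$-form $\Omega$ on a surface over $k$ is a rational function $f$ with $df\neq0$ and $df\wedge\Omega=0$ (so that the foliation is the kernel of $df$ on a dense open subset). $\mathbf{F}_p\subset k$ is the prime field. *)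

(* Defs.v *)
From mathcomp Require Import all_boot all_order all_algebra.
From mathcomp Require Import mpoly.
From mathcomp Require Import ring.

Set Implicit Arguments.
Unset Strict Implicit.
Unset Printing Implicit Defensive.

Import GRing.Theory.
Local Open Scope ring_scope.
Local Open Scope quotient_scope.

(* Rational functions and rational differential forms on P^2 are handled by
   their pull-backs along the submersion A^3 \ {0} -> P^2; this pull-back is
   injective on rational functions, 1-forms and 2-forms, so the conditions
   df <> 0 and df /\ Omega = 0 can be read on A^3. *)
Section RationalForms.
Variable k : fieldType.

Definition ratfun3 := {fraction {mpoly k[3]}}.

Definition is_ratfun_P2 (f : ratfun3) : Prop :=
  exists d : nat, exists P Q : {mpoly k[3]},
    [/\ P \is d.-homog, Q \is d.-homog, Q != 0
      & f = FracField.tofrac P / FracField.tofrac Q].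

(* Quotient rule on the representative of f chosen by the library; pderiv_div
   below shows that the choice does not matter. *)
Definition pderiv (i : 'I_3) (f : ratfun3) : ratfun3 :=
  let n := \n_(repr f) in
  let d := \d_(repr f) in
  FracField.tofrac (mderiv i n * d - n * mderiv i d)
    / FracField.tofrac d ^+ 2.

(* The row vector (a, b, c) stands for a dx + b dy + c dz. *)
Definition form1 := 'rV[ratfun3]_3.

Definition differential (f : ratfun3) : form1 := \row_i pderiv i f.

(* The (i, j) entry is the coefficient of dx_i /\ dx_j (for i < j); the matrix
   is alternating. *)
Definition wedge (a b : form1) : 'M[ratfun3]_3 :=
  \matrix_(i, j) (a 0 i * b 0 j - a 0 j * b 0 i).

Definition is_rational_first_integral (Omega : form1) (f : ratfun3) : Prop :=
  [/\ is_ratfun_P2 f, differential f != 0 & wedge (differential f) Omega = 0].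

Definition has_rational_first_integral (Omega : form1) : Prop :=
  exists f : ratfun3, is_rational_first_integral Omega f.

Lemma repr_fracE (f : ratfun3) :
  f = FracField.tofrac \n_(repr f) / FracField.tofrac \d_(repr f).
Proof.
have dn0 := denom_ratioP (repr f).
apply: (mulIf (_ : FracField.tofrac \d_(repr f) != 0)).
  by rewrite tofrac_eq0.
rewrite divfK ?tofrac_eq0 // -{1}[f]reprK.
rewrite !piE; apply/eqP; rewrite -[_ == _]/(_ == _ %[mod _]).
rewrite FracField.equivf_def /FracField.equivf /FracField.mulf.
rewrite !numden_Ratio ?mulr1 ?oner_neq0 //.
by rewrite mulrC.
Qed.

Lemma pderiv_div (i : 'I_3) (P Q : {mpoly k[3]}) : Q != 0 ->
  pderiv i (FracField.tofrac P / FracField.tofrac Q) =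
  FracField.tofrac (mderiv i P * Q - P * mderiv i Q)
    / FracField.tofrac Q ^+ 2.
Proof.
move=> Q0; rewrite /pderiv; set f := FracField.tofrac P / FracField.tofrac Q.
have := repr_fracE f; have := denom_ratioP (repr f).
move: (\n_(repr f)) (\d_(repr f)) => n d d0.
rewrite /f => /eqP; rewrite eqr_div ?tofrac_eq0 // -!tofracM tofrac_eq.
move=> /eqP e; have e' := congr1 (mderiv i) e.
rewrite !mderivM in e'.
apply/eqP; rewrite eqr_div ?expf_neq0 ?tofrac_eq0 //.
rewrite -!tofracXn -!tofracM tofrac_eq; apply/eqP.
apply/eqP; rewrite -subr_eq0; apply/eqP.
move: (mderiv i n) (mderiv i d) (mderiv i P) (mderiv i Q) e' => n' d' P' Q' e'.
have -> : (n' * d - n * d') * Q ^+ 2 - (P' * Q - P * Q') * d ^+ 2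
  = (P * d - n * Q) * (d' * Q + d * Q')
    - (P' * d + P * d' - (n' * Q + n * Q')) * (d * Q) by ring.
by rewrite e e' !subrr !mul0r subrr.
Qed.

End RationalForms.

Section FoliationF4.
Variable k : fieldType.

Let x : {mpoly k[3]} := 'X_(@Ordinal 3 0 isT).
Let y : {mpoly k[3]} := 'X_(@Ordinal 3 1 isT).
Let z : {mpoly k[3]} := 'X_(@Ordinal 3 2 isT).

(* None encodes alpha = infinity. *)
Definition F4_coefs (alpha : option k) : seq {mpoly k[3]} :=
  if alpha is Some a then
    [:: (y ^+ 3 - z ^+ 3) * (y * z - a *: x ^+ 2);
        (z ^+ 3 - x ^+ 3) * (x * z - a *: y ^+ 2);
        (x ^+ 3 - y ^+ 3) * (x * y - a *: z ^+ 2)]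
  else
    [:: (y ^+ 3 - z ^+ 3) * x ^+ 2;
        (z ^+ 3 - x ^+ 3) * y ^+ 2;
        (x ^+ 3 - y ^+ 3) * z ^+ 2].

Definition F4_form (alpha : option k) : form1 k :=
  \row_(i < 3) FracField.tofrac (F4_coefs alpha)`_i.

(* The contraction with the Euler vector field vanishes, so that the form does
   define a foliation on P^2. *)
Lemma F4_coefs_euler (alpha : option k) :
  x * (F4_coefs alpha)`_0 + y * (F4_coefs alpha)`_1
    + z * (F4_coefs alpha)`_2 = 0.
Proof. by case: alpha => [a|] /=; rewrite -?mul_mpolyC; ring. Qed.

End FoliationF4.

Definition in_prime_field (p : nat) (k : fieldType) (a : k) : Prop :=
  exists c : 'F_p, a = (c : nat)%:R.

(* Main.v *)
Require Import Defs.
From mathcomp Require Import all_boot all_order all_algebra.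
From mathcomp Require Import mpoly.
From mathcomp Require Import ring zify.

(* Put P = y^3 - z^3, Q = z^3 - x^3, A = x^2y + y^2z + z^2x and
   B = xy^2 + yz^2 + zx^2.  The form F4_alpha is the combination
   (A dB - B dA) + ((alpha - 1)/3) (P dQ - Q dP), and both generators of this
   pencil become closed, indeed pull-backs of the invariant differential of
   an elliptic curve with j = 0, once divided by S^(2/3), where
   S = PQ(P + Q) = A^3 - B^3.  Up to p-th powers S^(-2/3) is S^N, with N = n if
   p = 3n + 2 and N = 2n if p = 3n + 1.

   Let D be a derivation.  In characteristic p the identity
   D^(p-1)(f^(p-1) Df) = f^(p-1) D^p f - (Df)^p, applied to the monomials of
   S^N in (P, Q) and in (A, B), gives for each generator w
     D^(p-1)(S^N w(D)) = S^N w(D^p) - c w(D)^p,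
   where the Hasse invariant c is 0 if p = 3n + 2 and binomial(2n, n) if
   p = 3n + 1.  So if D spans the kernel of F4_alpha then D^p stays in that
   kernel if and only if c = 0 or alpha^p = alpha.

   If f is a first integral, D kills f, hence so does D^p, and D^p is again in
   the kernel.  Conversely, when D^p is in the kernel, normalize D by Dt = 1 for
   a coordinate t: then D^p = 0, and the components of the other coordinate
   on the powers of t are constants of D, not all of them with zero
   differential. *)

Set Implicit Arguments.
Unset Strict Implicit.
Unset Printing Implicit Defensive.

Import GRing.Theory.
Local Open Scope ring_scope.

Local Notation "P %:F" := (FracField.tofrac P).

Local Notation i0 := (@Ordinal 3 0 isT).
Local Notation i1 := (@Ordinal 3 1 isT).
Local Notation i2 := (@Ordinal 3 2 isT).

(** * Arithmetic modulo [p] *)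

Lemma prime_ndvd_fact p m : prime p -> (m < p)%N -> ~~ (p %| m`!)%N.
Proof.
move=> p_prime; elim: m => [|m IH] mp.
  by rewrite dvdn1 neq_ltn prime_gt1 ?orbT.
by rewrite factS Euclid_dvdM // negb_or gtnNdvd // IH // ltnW.
Qed.

(** This makes the Hasse invariant nonzero when [p = 3n + 1]: ['C(2n, n)] divides [(2n)!], a product
    of factors smaller than [p]. *)
Lemma prime_ndvd_central_bin p n :
  prime p -> (2 * n < p)%N -> ~~ (p %| 'C(2 * n, n))%N.
Proof.
move=> p_prime np; apply: contra (prime_ndvd_fact p_prime np) => pC.
by rewrite -(@bin_fact _ n) ?dvdn_mulr // leq_pmull.
Qed.

(** The images of [0, ..., p - 1] are already [p] distinct roots of [X^p - X], which leaves no room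
    for another one. *)
Lemma frobenius_fixedP (F : fieldType) (p : nat) (a : F) :
  p \in [pchar F] -> a ^+ p = a <-> in_prime_field p a.
Proof.
move=> pcharF; have p_prime := pcharf_prime pcharF; split; last first.
  by case=> c ->; rewrite -(pFrobenius_autE pcharF) pFrobenius_aut_nat.
move=> ap; pose s := [seq i%:R : F | i <- iota 0 p].
have us : uniq s.
  rewrite map_inj_in_uniq ?iota_uniq // => i j.
  rewrite !mem_iota /= !add0n => ip jp /eqP.
  wlog ij : i j ip jp / (i <= j)%N => [H|].
    case: (leqP i j) => [|/ltnW] ij e; [|symmetry]; apply: H => //.
    by rewrite eq_sym.
  rewrite eq_sym -subr_eq0 -natrB // -(dvdn_pcharf pcharF) => pij.
  apply/eqP; rewrite eqn_leq ij /= -subn_eq0; move: pij.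
  by case: (j - i)%N (leq_subr i j) => [|d] dj // /dvdn_leq; lia.
have [|aNs] := boolP (a \in s).
  case/mapP => i; rewrite mem_iota /= add0n => ip ->.
  by exists (i%:R); rewrite val_Fp_nat // modn_small.
have p1 := prime_gt1 p_prime.
have sizeq : size ('X^p - 'X : {poly F}) = p.+1.
  by rewrite size_polyDl ?size_polyXn // size_polyN size_polyX ltnS.
have q0 : ('X^p - 'X : {poly F}) != 0 by rewrite -size_poly_eq0 sizeq.
have roots_as : all (root ('X^p - 'X)) (a :: s).
  rewrite /= rootE !hornerE ap subrr eqxx; apply/allP => _ /mapP[i _ ->].
  by rewrite rootE !hornerE -(pFrobenius_autE pcharF) pFrobenius_aut_nat subrr.
have := max_poly_roots q0 roots_as.
by rewrite sizeq /= aNs us size_map size_iota ltnn => /(_ isT).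
Qed.

(** * Derivations of a field and their iterates *)

Section Derivations.
Variable K : fieldType.

Definition is_derivation (D : K -> K) : Prop :=
  {morph D : a b / a + b} /\ forall a b, D (a * b) = D a * b + a * D b.

Section OneDerivation.
Variable D : K -> K.
Hypothesis derD : is_derivation D.

Lemma derivationD a b : D (a + b) = D a + D b. Proof. exact: derD.1. Qed.

Lemma derivationM a b : D (a * b) = D a * b + a * D b. Proof. exact: derD.2. Qed.

Lemma derivation0 : D 0 = 0.
Proof. by apply: (addrI (D 0)); rewrite -derivationD !addr0. Qed.

Lemma derivation1 : D 1 = 0.
Proof.
by apply: (addrI (D 1)); rewrite -{3}[1]mulr1 derivationM mulr1 mul1r addr0.
Qed.

Lemma derivationN a : D (- a) = - D a.
Proof. by apply: (addrI (D a)); rewrite -derivationD !subrr derivation0. Qed.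

Lemma derivationB a b : D (a - b) = D a - D b.
Proof. by rewrite derivationD derivationN. Qed.

Lemma derivationMn a n : D (a *+ n) = D a *+ n.
Proof.
elim: n => [|n IH]; first by rewrite !mulr0n derivation0.
by rewrite !mulrS derivationD IH.
Qed.

Lemma derivation_sum (I : Type) (r : seq I) (F : I -> K) :
  D (\sum_(i <- r) F i) = \sum_(i <- r) D (F i).
Proof. exact: (big_morph D derivationD derivation0). Qed.

Lemma derivationX a n : D (a ^+ n) = (a ^+ n.-1 * D a) *+ n.
Proof.
elim: n => [|n IH]; first by rewrite expr0 derivation1 mulr0n.
rewrite exprS derivationM IH /= mulrS mulrC; congr (_ + _).
by case: n {IH} => [|n]; rewrite ?mulr0n ?mulr0 //= mulrnAr mulrA -exprS.
Qed.

Lemma derivationV a : D a^-1 = - (D a / a ^+ 2).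
Proof.
have [->|a0] := eqVneq a 0; first by rewrite invr0 derivation0 mul0r oppr0.
apply: (mulfI a0); apply: (addrI (D a * a^-1)).
by rewrite -derivationM divff // derivation1; field.
Qed.

Lemma iter_derivationD n a b : iter n D (a + b) = iter n D a + iter n D b.
Proof. by elim: n => //= n ->; rewrite derivationD. Qed.

Lemma iter_derivation0 n : iter n D 0 = 0.
Proof. by elim: n => //= n ->; rewrite derivation0. Qed.

Lemma iter_derivationN n a : iter n D (- a) = - iter n D a.
Proof. by elim: n => //= n ->; rewrite derivationN. Qed.

Lemma iter_derivationMn n a m : iter n D (a *+ m) = iter n D a *+ m.
Proof. by elim: n => //= n ->; rewrite derivationMn. Qed.

Lemma iter_derivation_sum n (I : Type) (r : seq I) (F : I -> K) :
  iter n D (\sum_(i <- r) F i) = \sum_(i <- r) iter n D (F i).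
Proof.
exact: (big_morph (iter n D) (iter_derivationD n) (iter_derivation0 n)).
Qed.

Lemma iter_derivationZ n c a : D c = 0 -> iter n D (c * a) = c * iter n D a.
Proof. by move=> Dc; elim: n => //= n ->; rewrite derivationM Dc mul0r add0r. Qed.

Lemma iter_derivationM n a b :
  iter n D (a * b) =
  \sum_(i < n.+1) (iter (n - i) D a * iter i D b) *+ 'C(n, i).
Proof.
elim: n => [|n IH]; first by rewrite big_ord_recl big_ord0 addr0.
rewrite iterS IH derivation_sum.
under eq_bigr => i _ do rewrite derivationMn derivationM mulrnDl.
rewrite big_split /= [X in X + _]big_ord_recl /= [RHS]big_ord_recl /=.
rewrite !subn0 !bin0 -addrA; congr (_ + _); apply/esym.
transitivity (
    \sum_(i < n.+1) (iter (n - i) D a * iter i.+1 D b) *+ 'C(n, i.+1) +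
    \sum_(i < n.+1) (iter (n - i) D a * iter i.+1 D b) *+ 'C(n, i)).
  rewrite -big_split; apply: eq_bigr => i _.
  by rewrite /bump /= add1n subSS binS mulrnDr.
congr (_ + _).
rewrite big_ord_recr /= bin_small ?ltnSn // mulr0n addr0.
by apply: eq_bigr => i _; rewrite /bump /= add1n -!iterS subnSK.
Qed.

End OneDerivation.

Lemma is_derivation_comb (D E : K -> K) (u v : K) :
  is_derivation D -> is_derivation E ->
  is_derivation (fun f => u * D f + v * E f).
Proof.
move=> derD derE; split=> f g.
  by rewrite (derivationD derD) (derivationD derE) !mulrDr addrACA.
by rewrite (derivationM derD) (derivationM derE); ring.
Qed.

(** * Iterated derivations in characteristic [p] *)

Section CharP.
Variable p : nat.
Hypothesis pcharK : p \in [pchar K].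

Let p_prime : prime p. Proof. exact: pcharf_prime pcharK. Qed.
Let p_gt0 : (0 < p)%N. Proof. exact: prime_gt0. Qed.

(** The inner binomial coefficients of the Leibniz formula for [iter p D] are divisible by [p]. *)
Lemma iter_derivation_pchar D : is_derivation D -> is_derivation (iter p D).
Proof.
move=> derD; split=> [a b|a b]; first exact: iter_derivationD.
have max_neq0 : ord_max != ord0 :> 'I_p.+1 by rewrite -val_eqE /= -lt0n.
rewrite iter_derivationM // (bigD1 ord0) // (bigD1 ord_max) //=.
rewrite subn0 subnn bin0 binn !mulr1n big1 ?addr0 //= => i /andP[i0 ip].
rewrite -mulr_natr bin_lt_pcharf_0 ?mulr0 // lt0n ltn_neqAle -ltnS ltn_ord.
by rewrite andbT -!val_eqE in i0 ip *; rewrite i0.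
Qed.

Lemma derivation_Xpchar D a : is_derivation D -> D (a ^+ p) = 0.
Proof. by move=> derD; rewrite derivationX // -mulr_natr pcharf0 // mulr0. Qed.

Section Powers.
Variable D : K -> K.
Hypothesis derD : is_derivation D.

Implicit Types (x w : K) (m n : nat).

(* The sum is the [m]-fold commutator of [D ^ n] with multiplication by [x],
   applied to [w]; each commutator with [x] turns one factor [D] into [D x]. *)
Let comm x m n w : K :=
  \sum_(j < m.+1) ((- x) ^+ (m - j) * iter n D (x ^+ j * w)) *+ 'C(m, j).

Let comm0 x m w : comm x m 0 w = w *+ (m == 0).
Proof.
rewrite /comm /=; under eq_bigr => j _ do rewrite mulrA -mulrnAl.
rewrite -mulr_suml -exprDn addNr expr0n.
by case: m => [|m]; rewrite /= ?mul1r ?mul0r.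
Qed.

(** The outer [D] also differentiates [(- x) ^+ (m - j)]; the identity
    [(m - j) 'C(m, j) = m 'C(m - 1, j)] collects these extra terms into a commutator of order
    [m - 1]. *)
Let commS x m n w :
  comm x m n.+1 w = D (comm x m n w) + (D x * comm x m.-1 n w) *+ m.
Proof.
have -> : D (comm x m n w) =
    \sum_(j < m.+1) (D ((- x) ^+ (m - j)) * iter n D (x ^+ j * w)) *+ 'C(m, j) +
    comm x m n.+1 w.
  rewrite /comm (derivation_sum derD) -big_split; apply: eq_bigr => j _.
  by rewrite (derivationMn derD) (derivationM derD) mulrnDl.
rewrite [X in _ = X + _]addrC -addrA -[LHS]addr0; congr (_ + _); apply/esym.
rewrite /comm; case: m => [|m].
  by rewrite big_ord_recl big_ord0 /= (derivation1 derD) mul0r !addr0.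
rewrite mulr_sumr -sumrMnl big_ord_recr /= subnn expr0.
rewrite (derivation1 derD) mul0r mul0rn.
rewrite addr0 -big_split /= big1 //= => j _.
have jm : (j <= m)%N by rewrite -ltnS.
rewrite subSn // (derivationX derD) (derivationN derD) //=.
have e : (m - j).+1%:R * 'C(m.+1, j)%:R = m.+1%:R * 'C(m, j)%:R :> K.
  by rewrite -!natrM mul_bin_down subSn.
rewrite -!(mulr_natr (_ * _)); move: ((- x) ^+ (m - j)) (iter n D _) e => u t.
move: (m - j).+1%:R 'C(m.+1, j)%:R m.+1%:R 'C(m, j)%:R => c1 c2 c3 c4 e.
have -> : u * - D x * c1 * t * c2 = - (u * D x * t * (c1 * c2)) by ring.
by rewrite e; ring.
Qed.

Let comm_lt x m n w : (n < m)%N -> comm x m n w = 0.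
Proof.
elim: n m => [|n IH] [|m] // nm.
by rewrite commS IH ?(ltnW nm) // IH // mulr0 mul0rn (derivation0 derD) addr0.
Qed.

Let comm_diag x m w : comm x m m w = (D x ^+ m * w) *+ m`!.
Proof.
elim: m => [|m IH]; first by rewrite comm0 mul1r.
rewrite commS comm_lt // (derivation0 derD) add0r IH mulrnAr -mulrnA mulrA.
by rewrite -exprS factS mulnC.
Qed.

(** Take [m = p - 1] and [w = D x] in [comm_diag]: by Wilson's theorem the right-hand side is
    [- D x ^+ p], and every term of the sum but the last has a primitive. *)
Lemma iter_derivation_expM_pred x :
  iter p.-1 D (x ^+ p.-1 * D x) = x ^+ p.-1 * iter p D x - D x ^+ p.
Proof.
have := comm_diag x p.-1 (D x).
rewrite /comm big_ord_recr /= subnn expr0 mul1r binn mulr1n.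
have p1 : (p.-1).+1 = p := prednK p_gt0.
have -> : \sum_(j < p.-1)
      ((- x) ^+ (p.-1 - j) * iter p.-1 D (x ^+ j * D x)) *+ 'C(p.-1, j) =
    - (x ^+ p.-1 * iter p D x).
  (* [(j + 1) x ^+ j * D x] is [D (x ^+ j.+1)], and [j + 1 < p] is invertible. *)
  have E (j : 'I_p.-1) : iter p.-1 D (x ^+ j * D x) = x ^+ j * iter p D x.
    have j0 : j.+1%:R != 0 :> K.
      rewrite -(dvdn_pcharf pcharK) gtnNdvd //.
      by rewrite -[X in (_ < X)%N]p1 ltnS.
    apply: (mulfI j0); rewrite !mulr_natl -(iter_derivationMn derD).
    rewrite -(derivationX derD x j.+1).
    by rewrite -iterSr p1 (derivationX (iter_derivation_pchar derD)).
  under eq_bigr => j _ do rewrite E mulrA -mulrnAl.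
  rewrite -mulr_suml -mulNr; congr (_ * _).
  (* Expanding [(- x + x) ^+ p.-1 = 0] shows that the remaining coefficients sum to
     [- x ^+ p.-1]. *)
  have := exprDn (- x) x p.-1; rewrite big_ord_recr /= subnn mul1r binn mulr1n.
  rewrite addNr expr0n -subn1 subn_eq0 leqNgt prime_gt1 //= => /eqP.
  by rewrite eq_sym addr_eq0 => /eqP ->.
move=> /eqP; rewrite -mulr_natr.
have -> : (p.-1)`!%:R = -1 :> K.
  apply/eqP; rewrite -subr_eq0 opprK natr1 -(dvdn_pcharf pcharK).
  by rewrite -Wilson ?prime_gt1.
by rewrite mulrN1 -exprSr p1 addrC subr_eq addrC => /eqP.
Qed.

Definition wronskian (E : K -> K) a b := a * E b - b * E a.

(** As [a + 1 = - (b + 1)] in [K], the argument is [D (x ^+ a.+1 * w ^+ b.+1)] divided by [b + 1];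
    the same formula holds for the derivation [iter p D]. *)
Lemma iter_derivation_monomial x w a b :
  (p %| a + b + 2)%N -> ~~ (p %| b.+1)%N ->
  iter p.-1 D (x ^+ a * w ^+ b * wronskian D x w) =
  x ^+ a * w ^+ b * wronskian (iter p D) x w.
Proof.
move=> pab pb.
have b0 : b.+1%:R != 0 :> K by rewrite -(dvdn_pcharf pcharK).
have aN : a.+1%:R = - b.+1%:R :> K.
  apply/eqP; rewrite -addr_eq0 -natrD -(dvdn_pcharf pcharK).
  by rewrite addSn addnS -addn2.
have derE E : is_derivation E -> E (x ^+ a.+1 * w ^+ b.+1) =
    (x ^+ a * w ^+ b * wronskian E x w) *+ b.+1.
  move=> derE; rewrite (derivationM derE) !(derivationX derE) /=.
  rewrite -!(mulr_natr (_ * _)) aN /wronskian !exprS.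
  by move: (b.+1%:R) => c; ring.
apply: (mulfI b0); rewrite !mulr_natl -(iter_derivationMn derD) -derE //.
by rewrite -iterSr (prednK p_gt0) derE //; apply: iter_derivation_pchar.
Qed.

(** The case [a = b = p - 1] excluded above. The argument splits into two terms covered by
    [iter_derivation_expM_pred], with coefficients [x ^+ p] and [w ^+ p] killed by [D]; the [p]-th
    powers recombine by additivity of Frobenius. *)
Lemma iter_derivation_monomial_pred x w :
  iter p.-1 D (x ^+ p.-1 * w ^+ p.-1 * wronskian D x w) =
  x ^+ p.-1 * w ^+ p.-1 * wronskian (iter p D) x w - wronskian D x w ^+ p.
Proof.
have p1 : (p.-1).+1 = p := prednK p_gt0.
have Dp c : D (c ^+ p) = 0 by exact: derivation_Xpchar.
have -> : x ^+ p.-1 * w ^+ p.-1 * wronskian D x w =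
    x ^+ p * (w ^+ p.-1 * D w) - w ^+ p * (x ^+ p.-1 * D x).
  by rewrite /wronskian -p1 !exprS /=; ring.
rewrite (iter_derivationD derD) (iter_derivationN derD).
rewrite !(iter_derivationZ derD _ _ (Dp _)) !iter_derivation_expM_pred.
rewrite /wronskian -!(pFrobenius_autE pcharK) rmorphB !rmorphM /=.
have xp (c : K) : c ^+ p = c * c ^+ p.-1 by rewrite -exprS p1.
by rewrite !pFrobenius_autE (xp x) (xp w); ring.
Qed.

(** Only the index [j], with monomial [(x * w) ^+ p.-1], contributes a [p]-th power. If [j > n],
    there is no such term and ['C(n, j)] is zero. *)
Lemma iter_derivation_binomial (n j : nat) (a b : nat -> nat) x w :
    (forall i, i <= n -> p %| a i + b i + 2)%N ->
    (forall i, i <= n -> i != j -> ~~ (p %| (b i).+1))%N ->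
    (j <= n -> a j = p.-1 /\ b j = p.-1)%N ->
  let f := \sum_(i < n.+1) (x ^+ a i * w ^+ b i) *+ 'C(n, i) in
  iter p.-1 D (f * wronskian D x w) =
  f * wronskian (iter p D) x w - 'C(n, j)%:R * wronskian D x w ^+ p.
Proof.
move=> pab pb abj f; rewrite !mulr_suml (iter_derivation_sum derD).
have E (i : 'I_n.+1) : val i != j ->
    iter p.-1 D ((x ^+ a i * w ^+ b i) *+ 'C(n, i) * wronskian D x w) =
    (x ^+ a i * w ^+ b i) *+ 'C(n, i) * wronskian (iter p D) x w.
  move=> ij; have i_n : (i <= n)%N by rewrite -ltnS.
  rewrite !mulrnAl (iter_derivationMn derD) iter_derivation_monomial //.
    exact: pab.
  exact: pb.
have [jn|jn] := leqP j n; last first.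
  rewrite bin_small // mul0r subr0; apply: eq_bigr => i _; apply: E.
  by rewrite neq_ltn (leq_trans _ jn) // ltn_ord.
have [aj bj] := abj jn; pose j' := Ordinal (jn : (j < n.+1)%N).
rewrite (bigD1 j') //= [in RHS](bigD1 j') //= aj bj.
rewrite !mulrnAl (iter_derivationMn derD) iter_derivation_monomial_pred.
rewrite mulrnBl mul1r addrAC; congr (_ + _); congr (_ + _).
by apply: eq_bigr => i ij; apply: E.
Qed.

End Powers.

(** * The pencil of forms and its Hasse invariant *)

Section Pencil.
Variables x y z : K.

(** The forms of parameters [0] and infinity are contracted with a vector [(u, v, w)], so that the
    same expressions serve for [D] and for [iter p D]. *)
Definition F4_0 u v w := (y ^+ 3 - z ^+ 3) * (y * z) * u
  + (z ^+ 3 - x ^+ 3) * (x * z) * v + (x ^+ 3 - y ^+ 3) * (x * y) * w.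

Definition F4_oo u v w := (y ^+ 3 - z ^+ 3) * x ^+ 2 * u
  + (z ^+ 3 - x ^+ 3) * y ^+ 2 * v + (x ^+ 3 - y ^+ 3) * z ^+ 2 * w.

Let P := y ^+ 3 - z ^+ 3.
Let Q := z ^+ 3 - x ^+ 3.
Let A := x ^+ 2 * y + y ^+ 2 * z + z ^+ 2 * x.
Let B := x * y ^+ 2 + y * z ^+ 2 + z * x ^+ 2.

Lemma wronskian_cubes E : is_derivation E ->
  wronskian E P Q = - (F4_oo (E x) (E y) (E z) *+ 3).
Proof.
move=> derE; rewrite /wronskian !(derivationB derE) !(derivationX derE).
by rewrite /F4_oo /P /Q /=; ring.
Qed.

Lemma derivation_cubes_ratio E : is_derivation E -> x ^+ 3 - z ^+ 3 != 0 ->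
  E ((x ^+ 3 - y ^+ 3) / (x ^+ 3 - z ^+ 3)) =
  3%:R / (x ^+ 3 - z ^+ 3) ^+ 2 * F4_oo (E x) (E y) (E z).
Proof.
move=> derE xz0; rewrite (derivationM derE) (derivationV derE).
rewrite !(derivationB derE) !(derivationX derE) /F4_oo /=; field.
exact: xz0.
Qed.

Lemma wronskian_mixed E : is_derivation E ->
  wronskian E A (- B) =
  F4_oo (E x) (E y) (E z) - F4_0 (E x) (E y) (E z).
Proof.
move=> derE; rewrite /wronskian (derivationN derE) !(derivationD derE).
rewrite !(derivationM derE).
by rewrite /F4_oo /F4_0 /A /B /=; ring.
Qed.

Lemma F4_pencilE a u v w : F4_0 u v w - a * F4_oo u v w =
  (y ^+ 3 - z ^+ 3) * (y * z - a * x ^+ 2) * u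
  + (z ^+ 3 - x ^+ 3) * (x * z - a * y ^+ 2) * v
  + (x ^+ 3 - y ^+ 3) * (x * y - a * z ^+ 2) * w.
Proof. by rewrite /F4_0 /F4_oo; ring. Qed.

(** The vector is a field in the kernel of the form of parameter [a] that kills [z]; the value, free
    of [a], shows that this field is not in the kernel of [F4_oo]. *)
Lemma F4_oo_tangent a :
  F4_oo ((z ^+ 3 - x ^+ 3) * (x * z - a * y ^+ 2))
        (- ((y ^+ 3 - z ^+ 3) * (y * z - a * x ^+ 2))) 0 =
  P * Q * z * (x ^+ 3 - y ^+ 3).
Proof. by rewrite /F4_oo /P /Q; ring. Qed.

(** The equation of the nine lines of the dual Hesse arrangement, since [P + Q = y^3 - x^3]. *)
Definition lines := P * Q * (P + Q).

(** With the sign put on [B], this is a sum of two cubes, so [lines ^+ N] has binomial expansions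
    with the same coefficients in [(P, Q)] and in [(A, - B)]. *)
Lemma lines_mixed : lines = A ^+ 3 + (- B) ^+ 3.
Proof. by rewrite /lines /P /Q /A /B; ring. Qed.

Lemma lines_neq0 : x ^+ 3 != y ^+ 3 -> y ^+ 3 != z ^+ 3 -> z ^+ 3 != x ^+ 3 ->
  lines != 0.
Proof.
move=> xy yz zx; rewrite /lines /P /Q addrA subrK !mulf_neq0 ?subr_eq0 //.
by rewrite eq_sym.
Qed.

Variables n N j : nat.
Hypothesis p_gt3 : (3 < p)%N.
(* ['C(N, j)] is the coefficient of [(P * Q) ^+ p.-1] in [lines ^+ N]; there is
   no such monomial when [p = 3n + 2], and then ['C(N, j) = 0]. *)
Hypothesis nNj : (p = 3 * n + 1 /\ N = 2 * n /\ j = n \/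
                  p = 3 * n + 2 /\ N = n /\ j = n + 1)%N.

Let dvdp m : (0 < m)%N -> (m < 2 * p)%N -> m <> p -> ~~ (p %| m)%N.
Proof.
move=> m0 m2 mp; apply/negP => /dvdnP[q mq].
by case: q mq => [|[|q]] mq; nia.
Qed.

Variables (D : K -> K) (a : K).
Hypothesis derD : is_derivation D.
Hypothesis Da : D a = 0.

Let omega_oo E := F4_oo (E x) (E y) (E z).
Let omega_0 E := F4_0 (E x) (E y) (E z).

(** The monomials of [lines ^+ N] have degree [3N] in [(P, Q)], and [3N + 2] is [2p] if [p = 3n + 1]
    and [p] if [p = 3n + 2], as [iter_derivation_binomial] requires. *)
Lemma iter_derivation_F4_oo :
  iter p.-1 D (lines ^+ N * omega_oo D) =
  lines ^+ N * omega_oo (iter p D) - 'C(N, j)%:R * omega_oo D ^+ p.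
Proof.
have derDp := iter_derivation_pchar derD.
have LE : lines ^+ N =
    \sum_(i < N.+1) (P ^+ (N + (N - i)) * Q ^+ (N + i)) *+ 'C(N, i).
  rewrite /lines exprMn exprDn mulr_sumr; apply: eq_bigr => i _.
  by rewrite mulrnAr exprMn !exprD mulrACA.
(* The factor [- 3] of [wronskian_cubes] can be cleared: it is a nonzero constant fixed by
   Frobenius. *)
have c0 : - 3%:R != 0 :> K by rewrite oppr_eq0 -(dvdn_pcharf pcharK) gtnNdvd.
have cE u : - (u *+ 3) = - 3%:R * u by rewrite mulNr mulr_natl.
apply: (mulfI c0).
rewrite -(iter_derivationZ derD _ _ (_ : D (- 3%:R) = 0)); last first.
  by rewrite (derivationN derD) (derivationMn derD) (derivation1 derD) mul0rn oppr0.
rewrite mulrBr ![- 3%:R * (_ ^+ N * _)]mulrCA -!cE.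
rewrite -(wronskian_cubes derD) -(wronskian_cubes derDp).
have -> : - ('C(N, j)%:R * omega_oo D ^+ p *+ 3) =
    'C(N, j)%:R * wronskian D P Q ^+ p.
  rewrite (wronskian_cubes derD) -!(pFrobenius_autE pcharK).
  by rewrite rmorphN rmorphMn /= mulrN mulrnAr.
rewrite LE; apply: (@iter_derivation_binomial _ derD N j
                      (fun i => N + (N - i))%N (fun i => N + i)%N P Q).
- move=> i iN; case: nNj => [[pE [NE jE]]|[pE [NE jE]]].
    by apply/dvdnP; exists 2%N; lia.
  by apply/dvdnP; exists 1%N; lia.
- by move=> i iN ij; case: nNj => [[pE [NE jE]]|[pE [NE jE]]]; apply: dvdp; lia.
- by move=> jN; lia.
Qed.

(** The exponents of [A] and [- B] are [3(N - i)] and [3i], again of sum [3N]; the exceptional index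
    is the same [j], hence so is the Hasse invariant. *)
Lemma iter_derivation_F4_mixed :
  iter p.-1 D (lines ^+ N * (omega_oo D - omega_0 D)) =
  lines ^+ N * (omega_oo (iter p D) - omega_0 (iter p D))
  - 'C(N, j)%:R * (omega_oo D - omega_0 D) ^+ p.
Proof.
have derDp := iter_derivation_pchar derD.
rewrite -(wronskian_mixed derD) -(wronskian_mixed derDp).
rewrite lines_mixed exprDn.
under eq_bigr => i _ do rewrite -!exprM.
apply: (@iter_derivation_binomial _ derD N j
          (fun i => 3 * (N - i))%N (fun i => 3 * i)%N A (- B)).
- move=> i iN; case: nNj => [[pE [NE jE]]|[pE [NE jE]]].
    by apply/dvdnP; exists 2%N; lia.
  by apply/dvdnP; exists 1%N; lia.
- by move=> i iN ij; case: nNj => [[pE [NE jE]]|[pE [NE jE]]]; apply: dvdp; lia.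
- by move=> jN; lia.
Qed.

(** As a constant of [D], [a] passes through [iter p.-1 D] unchanged. The last bracket thus has [a]
    where [(omega_0 D - a * omega_oo D) ^+ p] would have [a ^+ p]. *)
Lemma iter_derivation_F4 :
  iter p.-1 D (lines ^+ N * (omega_0 D - a * omega_oo D)) =
  lines ^+ N * (omega_0 (iter p D) - a * omega_oo (iter p D))
  - 'C(N, j)%:R * (omega_0 D ^+ p - a * omega_oo D ^+ p).
Proof.
have -> : lines ^+ N * (omega_0 D - a * omega_oo D) =
    (1 - a) * (lines ^+ N * omega_oo D) - lines ^+ N * (omega_oo D - omega_0 D).
  by ring.
have D1a : D (1 - a) = 0.
  by rewrite (derivationB derD) (derivation1 derD) Da subrr.
rewrite (iter_derivationD derD) (iter_derivationN derD).
rewrite (iter_derivationZ derD _ _ D1a) iter_derivation_F4_oo.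
rewrite iter_derivation_F4_mixed -!(pFrobenius_autE pcharK) rmorphB /=.
move: (Frobenius_aut _ _) (Frobenius_aut _ _) => u v; ring.
Qed.

End Pencil.
(* [V ^ n] sends [n! u - t ^ n V ^ n u] to [0], so one can induct on the
   nilpotency order [n] as long as [n!] is invertible. *)
Lemma nilpotent_derivation_constant (V E : K -> K) (H : K -> Prop) (t u : K) n :
    is_derivation V -> is_derivation E ->
    (forall a b, H a -> H b -> H (a - b)) ->
    (forall a b, H a -> H b -> H (a * b)) ->
    (forall a, H a -> H (V a)) ->
    H t -> V t = 1 -> E t = 0 ->
    (n <= p)%N -> H u -> iter n V u = 0 -> E u != 0 ->
  exists c, [/\ H c, V c = 0 & E c != 0].
Proof.
move=> derV derE HB HM HV Ht Vt Et.
have Hiter m a : H a -> H (iter m V a) by move=> Ha; elim: m => //= m; apply: HV.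
have HMn m a : H a -> H (a *+ m).
  move=> Ha; have H0 : H 0 by rewrite -(subrr a); apply: HB.
  elim: m => [|m IH]; first by rewrite mulr0n.
  (* Only differences are known to stay in [H], so the sum is written as [a - (0 - b)]. *)
  by rewrite mulrS -[a *+ m]opprK -[- (a *+ m)]sub0r; exact: HB (HB _ _ H0 IH).
have Hexp m c : H c -> H (t ^+ m * c).
  move=> Hc; elim: m => [|m IH]; first by rewrite expr0 mul1r.
  by rewrite exprS -mulrA; apply: HM.
have Vexp m c : V c = 0 -> iter m V (t ^+ m * c) = c *+ m`!.
  move=> Vc; elim: m => [|m IH]; first by rewrite expr0 mul1r.
  rewrite iterSr (derivationM derV) (derivationX derV) Vt Vc mulr0 addr0 mulr1.
  by rewrite mulrnAl (iter_derivationMn derV) IH -mulrnA factS mulnC.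
elim: n u => [|n IH] u np Hu Vu Eu.
  by move: Vu Eu => /= ->; rewrite (derivation0 derE) eqxx.
(* If [E] does not kill [V ^ n u], this is the constant sought; otherwise [E] maps the corrected
   element to [n! E u], still nonzero. *)
have [Eu'|Eu'] := eqVneq (E (iter n V u)) 0; last first.
  by exists (iter n V u); split=> //; apply: Hiter.
apply: (IH (u *+ n`! - t ^+ n * iter n V u) (ltnW np)).
- by apply: HB; [apply: HMn | apply/Hexp/Hiter].
- rewrite (iter_derivationD derV) (iter_derivationN derV) Vexp //.
  by rewrite (iter_derivationMn derV) subrr.
rewrite (derivationB derE) (derivationMn derE) (derivationM derE) Eu'.
rewrite (derivationX derE) Et mulr0 mul0rn mul0r mulr0 addr0 subr0.
rewrite -mulr_natr mulf_neq0 // -(dvdn_pcharf pcharK).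
exact: prime_ndvd_fact.
Qed.

End CharP.
End Derivations.

(** * Homogeneous polynomials and Euler's identity *)

Section HomogeneousDerivatives.
Variables (R : comNzRingType) (n : nat).

Lemma mulX_mderivX (i : 'I_n) m :
  'X_i * mderiv i 'X_[m] = (m i)%:R *: 'X_[m] :> {mpoly R[n]}.
Proof.
rewrite mderivX -scalerAr -mpolyXD; have [->|mi] := eqVneq (m i) 0%N.
  by rewrite !scale0r.
by rewrite addmC submK // lep1mP.
Qed.

(** The variable restores the degree lost by differentiation, which avoids a separate treatment of
    [d = 0]. *)
Lemma mulX_mderiv_homog (i j : 'I_n) d (P : {mpoly R[n]}) :
  P \is d.-homog -> 'X_j * mderiv i P \is d.-homog.
Proof.
move=> /dhomogP hP; rewrite [P]mpolyE raddf_sum mulr_sumr big_seq /=.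
apply: rpred_sum => m /hP md; rewrite mderivZ mderivX -!scalerAr.
apply: rpredZ; have [->|mi] := eqVneq (m i) 0%N.
  by rewrite scale0r rpred0.
have mE : (m - U_(i) + U_(i) = m)%MM by rewrite submK // lep1mP.
apply: rpredZ; rewrite -mpolyXD dhomogX -md -{2}mE /= !mdegD !mdeg1.
by rewrite addnC.
Qed.

Lemma euler_homog d (P : {mpoly R[n]}) :
  P \is d.-homog -> \sum_(i < n) 'X_i * mderiv i P = d%:R *: P.
Proof.
move=> /dhomogP hP; rewrite {1}[P]mpolyE.
under eq_bigr => i _ do rewrite raddf_sum mulr_sumr /=.
rewrite exchange_big [in RHS](mpolyE P) scaler_sumr !big_seq /=.
apply: eq_bigr => m /hP md.
under eq_bigr => i _ do rewrite mderivZ -scalerAr mulX_mderivX.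
by rewrite -scaler_sumr -scaler_suml -natr_sum -mdegE md !scalerA mulrC.
Qed.

End HomogeneousDerivatives.

(** * Derivations of the field of rational functions *)

Lemma quotient_ruleD (F : fieldType) (a a' b b' c c' d d' : F) :
  b != 0 -> d != 0 ->
  ((a' * d + a * d' + (c' * b + c * b')) * (b * d)
    - (a * d + c * b) * (b' * d + b * d')) / (b * d) ^+ 2 =
  (a' * b - a * b') / b ^+ 2 + (c' * d - c * d') / d ^+ 2.
Proof. by move=> b0 d0; field; rewrite b0 d0. Qed.

Lemma quotient_ruleM (F : fieldType) (a a' b b' c c' d d' : F) :
  b != 0 -> d != 0 ->
  ((a' * c + a * c') * (b * d) - a * c * (b' * d + b * d')) / (b * d) ^+ 2 =
  (a' * b - a * b') / b ^+ 2 * (c / d) + a / b * ((c' * d - c * d') / d ^+ 2).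
Proof. by move=> b0 d0; field; rewrite b0 d0. Qed.

Section RationalFunctions.
Variable k : fieldType.
Local Notation K := (ratfun3 k).
Implicit Types (f g : K) (P Q : {mpoly k[3]}).

Lemma ratfunP f : exists P Q, Q != 0 /\ f = P%:F / Q%:F.
Proof.
exists \n_(repr f), \d_(repr f); split; last exact: repr_fracE.
exact: denom_ratioP.
Qed.

Lemma pderiv_is_derivation i : is_derivation (@pderiv k i).
Proof.
split=> f g; case: (ratfunP f) => [P [Q [Q0 ->]]];
  case: (ratfunP g) => [P' [Q' [Q'0 ->]]].
  rewrite addf_div ?tofrac_eq0 // -!tofracM -tofracD !pderiv_div ?mulf_neq0 //.
  rewrite !mderivD !mderivM !(tofracB, tofracM, tofracD).
  by apply: quotient_ruleD; rewrite tofrac_eq0.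
rewrite mulf_div -!tofracM !pderiv_div ?mulf_neq0 //.
rewrite !mderivM !(tofracB, tofracM, tofracD).
by apply: quotient_ruleM; rewrite tofrac_eq0.
Qed.

Lemma pderiv_tofrac i P : pderiv i P%:F = (mderiv i P)%:F.
Proof.
rewrite -[P%:F]divr1 -tofrac1 pderiv_div ?oner_neq0 // tofrac1 expr1n divr1.
by rewrite mulr1 -mpolyC1 mderivC mulr0 subr0.
Qed.

Lemma pderiv_C i (c : k) : pderiv i (c%:MP_[3])%:F = 0.
Proof. by rewrite pderiv_tofrac mderivC tofrac0. Qed.

Lemma pderiv_X (i j : 'I_3) : pderiv i ('X_j : {mpoly k[3]})%:F = (i == j)%:R.
Proof.
rewrite pderiv_tofrac mderivX mnm1E eq_sym; have [<-|] := eqVneq i j.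
  have -> : (U_(i) - U_(i) = 0)%MM by apply/mnmP => l; rewrite !mnmE subnn.
  by rewrite scale1r mpolyX0 tofrac1.
by rewrite scale0r tofrac0.
Qed.

Lemma is_ratfun_P2_div d P Q :
  P \is d.-homog -> Q \is d.-homog -> Q != 0 -> is_ratfun_P2 (P%:F / Q%:F).
Proof. by exists d, P, Q. Qed.

Lemma is_ratfun_P2D f g : is_ratfun_P2 f -> is_ratfun_P2 g -> is_ratfun_P2 (f + g).
Proof.
case=> [d [P [Q [hP hQ Q0 ->]]]] [e [P' [Q' [hP' hQ' Q'0 ->]]]].
rewrite addf_div ?tofrac_eq0 // -!tofracM -tofracD.
apply: (@is_ratfun_P2_div (d + e)); rewrite ?mulf_neq0 ?dhomogM //.
by apply: dhomogD; [|rewrite addnC]; apply: dhomogM.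
Qed.

Lemma is_ratfun_P2M f g : is_ratfun_P2 f -> is_ratfun_P2 g -> is_ratfun_P2 (f * g).
Proof.
case=> [d [P [Q [hP hQ Q0 ->]]]] [e [P' [Q' [hP' hQ' Q'0 ->]]]].
rewrite mulf_div -!tofracM.
by apply: (@is_ratfun_P2_div (d + e)); rewrite ?mulf_neq0 ?dhomogM.
Qed.

Lemma is_ratfun_P2C (c : k) : is_ratfun_P2 (c%:MP_[3])%:F.
Proof.
rewrite -[_%:F]divr1 -tofrac1; apply: (@is_ratfun_P2_div 0).
- by rewrite -[c%:MP]mulr1 mul_mpolyC dhomogZ // dhomog1.
- exact: dhomog1.
- exact: oner_neq0.
Qed.

Lemma is_ratfun_P2N f : is_ratfun_P2 f -> is_ratfun_P2 (- f).
Proof.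
move=> hf; rewrite -mulN1r; apply: is_ratfun_P2M => //.
by rewrite -tofrac1 -tofracN -mpolyC1 -mpolyCN; apply: is_ratfun_P2C.
Qed.

Lemma is_ratfun_P2_pderiv i j f :
  is_ratfun_P2 f -> is_ratfun_P2 (('X_j)%:F * pderiv i f).
Proof.
case=> [d [P [Q [hP hQ Q0 ->]]]]; rewrite pderiv_div // mulrA -tofracXn -tofracM.
apply: (@is_ratfun_P2_div (d + d));
  [|exact: (dhomogM hQ hQ)|by rewrite expf_neq0].
rewrite mulrBr mulrA [X in _ - X]mulrCA.
by apply: rpredB; apply: dhomogM => //; apply: mulX_mderiv_homog.
Qed.

Lemma euler_ratfun_P2 f : is_ratfun_P2 f -> \sum_i ('X_i)%:F * pderiv i f = 0.
Proof.
case=> [d [P [Q [hP hQ Q0 ->]]]].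
have E (i : 'I_3) : ('X_i)%:F * pderiv i (P%:F / Q%:F) =
     ('X_i * mderiv i P * Q - P * ('X_i * mderiv i Q))%:F / Q%:F ^+ 2.
  rewrite pderiv_div // mulrA -tofracM; congr (_%:F / _).
  by rewrite mulrBr; congr (_ - _); [rewrite mulrA | rewrite mulrCA].
under eq_bigr => i _ do rewrite E.
rewrite -mulr_suml -raddf_sum big_split /= -mulr_suml sumrN -mulr_sumr.
rewrite (euler_homog hP) (euler_homog hQ) -!mul_mpolyC.
by rewrite mulrCA mulrA subrr tofrac0 mul0r.
Qed.

Lemma eq_ratfun_derivation (D E : K -> K) :
  is_derivation D -> is_derivation E ->
  (forall c, D (c%:MP_[3])%:F = E (c%:MP_[3])%:F) ->
  (forall i : 'I_3, D ('X_i)%:F = E ('X_i)%:F) -> D =1 E.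
Proof.
move=> derD derE DEc DEX.
have DEP P : D P%:F = E P%:F.
  elim/mpolyind: P => [|c m P _ _ IH].
    by rewrite tofrac0 (derivation0 derD) (derivation0 derE).
  rewrite tofracD (derivationD derD) (derivationD derE) IH -mul_mpolyC tofracM.
  rewrite (derivationM derD) (derivationM derE) DEc; congr (_ * _ + _ * _ + _).
  rewrite mpolyXE_id rmorph_prod /=.
  apply: (big_ind (fun f : K => D f = E f)) => [|f g Df Dg|i _].
  - by rewrite (derivation1 derD) (derivation1 derE).
  - by rewrite (derivationM derD) (derivationM derE) Df Dg.
  by rewrite tofracXn (derivationX derD) (derivationX derE) DEX.
move=> f; case: (ratfunP f) => [P [Q [Q0 ->]]].
rewrite (derivationM derD) (derivationM derE).
by rewrite (derivationV derD) (derivationV derE) !DEP.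
Qed.

(** The chain rule; applied to a [p]-th iterate, it expresses the effect on a first integral through
    the coordinates alone. *)
Lemma ratfun_derivationE (D : K -> K) f :
  is_derivation D -> (forall c, D (c%:MP_[3])%:F = 0) ->
  D f = \sum_i pderiv i f * D ('X_i)%:F.
Proof.
move=> derD Dc; move: f; apply: eq_ratfun_derivation => //.
- split=> f g.
    rewrite -big_split; apply: eq_bigr => i _.
    by rewrite (derivationD (pderiv_is_derivation i)) mulrDl.
  rewrite mulr_suml mulr_sumr -big_split; apply: eq_bigr => i _ /=.
  by rewrite (derivationM (pderiv_is_derivation i)) mulrDl mulrAC -[f * _ * _]mulrA.
- by move=> c; rewrite Dc big1 // => i _; rewrite pderiv_C mul0r.
move=> i; rewrite (bigD1 i) //= big1 ?addr0 => [|j ji].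
  by rewrite pderiv_X eqxx mul1r.
by rewrite pderiv_X (negPf ji) mul0r.
Qed.

End RationalFunctions.

(** * From a nilpotent vector field to a first integral *)

Lemma big_ord3 (V : nmodType) (F : 'I_3 -> V) :
  \sum_i F i = F i0 + F i1 + F i2.
Proof.
rewrite !big_ord_recl big_ord0 addr0 addrA.
by congr (F _ + F _ + F _); apply: val_inj.
Qed.

Lemma ord3_ind (T : 'I_3 -> Prop) : T i0 -> T i1 -> T i2 -> forall i, T i.
Proof.
by move=> T0 T1 T2 [[|[|[|//]]] H]; [move: T0 | move: T1 | move: T2];
  congr (T _); apply: val_inj.
Qed.

(** The covectors [(a, b, c)] and [(u, v, w)] both vanish on the independent vectors [(x, y, z)] and
    [(z, - z * a / b, 0)], so they are proportional. *)
Lemma tangent_and_euler (F : fieldType) (x y z u v w a b c : F) :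
  z != 0 -> b != 0 -> x * a + y * b + z * c = 0 -> x * u + y * v + z * w = 0 ->
  z * (u - a / b * v) = 0 -> u = v / b * a /\ w = v / b * c.
Proof.
move=> z0 b0 eab euv /eqP; rewrite mulf_eq0 (negPf z0) subr_eq0 => /eqP uE.
have -> : u = v / b * a by rewrite uE; field.
split=> //; apply: (mulfI z0).
have -> : z * w = - (x * u + y * v) by apply/eqP; rewrite -addr_eq0 addrC euv.
have -> : z * (v / b * c) = - (v / b * (x * a + y * b)).
  have -> : z * (v / b * c) = v / b * (z * c) by ring.
  have -> : z * c = - (x * a + y * b) by apply/eqP; rewrite -addr_eq0 addrC eab.
  by rewrite mulrN.
by rewrite uE; field.
Qed.

Lemma proportional_annihilates (F : fieldType) (a b c f0 f1 f2 u v w : F) :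
  f1 != 0 -> f0 * b = f1 * a -> f2 * b = f1 * c ->
  f0 * u + f1 * v + f2 * w = 0 -> a * u + b * v + c * w = 0.
Proof.
move=> f1_neq0 e0 e2 e; apply: (mulfI f1_neq0).
rewrite mulr0 -[RHS](mulr0 b) -e !mulrDr !mulrA -e0 -e2.
by rewrite ![b * _]mulrC.
Qed.

Section FirstIntegrals.
Variable k : fieldType.
Local Notation K := (ratfun3 k).
Local Notation X i := (('X_i : {mpoly k[3]})%:F).

Lemma mpolyX_neq0 (i : 'I_3) : ('X_i : {mpoly k[3]}) != 0.
Proof.
apply/eqP => /(congr1 (mcoeff U_(i)%MM))/eqP.
by rewrite mcoeffX mcoeff0 eqxx oner_eq0.
Qed.

Lemma mpolyX_homog (i : 'I_3) : ('X_i : {mpoly k[3]}) \is 1.-homog.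
Proof. by rewrite dhomogX /= mdeg1. Qed.

Lemma X_neq0 (i : 'I_3) : X i != 0.
Proof. by rewrite tofrac_eq0 mpolyX_neq0. Qed.

Lemma XX3_neq (i j : 'I_3) : i != j -> X i ^+ 3 != X j ^+ 3.
Proof.
move=> ij; rewrite -!tofracXn tofrac_eq; apply/eqP.
move=> /(congr1 (mcoeff (U_(i) *+ 3)%MM)); rewrite !mcoeffXn eqxx.
case: eqP => [/mnmP /(_ i)|_ /eqP]; last by rewrite oner_eq0.
by rewrite !mulmnE !mnm1E eqxx eq_sym (negPf ij).
Qed.

Lemma has_rational_first_integralW (Omega : form1 k) (f : K) (c : K) :
  is_ratfun_P2 f -> differential f = c *: Omega -> differential f != 0 ->
  has_rational_first_integral Omega.
Proof.
move=> hf df df0; exists f; split=> //; rewrite df.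
by apply/matrixP => i j; rewrite !mxE; ring.
Qed.

Variables (p : nat) (Omega : form1 k).
Hypothesis pchark : p \in [pchar K].

(** A field in the kernel of [Omega] with [V z = 0] and [V (x / z) = 1]; the factor [z] lets it
    preserve functions of degree zero once the ratio of coefficients has degree zero. *)
Let V (f : K) :=
  X i2 * pderiv i0 f + (- (X i2 * (Omega 0 i0 / Omega 0 i1))) * pderiv i1 f.

(** [nilpotent_derivation_constant], with [t = x / z], [u = y / z] and [E] the [y]-derivative, gives
    a constant of [V] on the plane with nonzero [y]-derivative; [tangent_and_euler] makes its
    differential a multiple of [Omega]. *)
Lemma first_integral_of_nilpotent :
  Omega 0 i1 != 0 -> is_ratfun_P2 (Omega 0 i0 / Omega 0 i1) ->
  X i0 * Omega 0 i0 + X i1 * Omega 0 i1 + X i2 * Omega 0 i2 = 0 ->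
  iter p V (X i1) = 0 ->
  has_rational_first_integral Omega.
Proof.
move=> O1 hO eulerO Vp.
have derV : is_derivation V.
  by apply: is_derivation_comb; apply: pderiv_is_derivation.
have der1 := pderiv_is_derivation k i1.
have VX2 : V (X i2) = 0 by rewrite /V !pderiv_X !mulr0 addr0.
have VX2V : V (X i2)^-1 = 0 by rewrite (derivationV derV) VX2 mul0r oppr0.
have hX (i : 'I_3) : is_ratfun_P2 (X i / X i2).
  by apply: (@is_ratfun_P2_div _ 1); rewrite ?mpolyX_homog ?mpolyX_neq0.
have VE f : V f = X i2 * (pderiv i0 f - Omega 0 i0 / Omega 0 i1 * pderiv i1 f).
  by rewrite /V mulrBr mulNr; congr (_ - _); apply/esym/mulrA.
have [] := @nilpotent_derivation_constant _ _ pchark V (@pderiv k i1)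
    (@is_ratfun_P2 k) (X i0 / X i2) (X i1 / X i2) p derV der1 _ _ _ _ _ _ _ _ _ _.
- by move=> f g hf hg; apply/is_ratfun_P2D/is_ratfun_P2N.
- by move=> f g; apply: is_ratfun_P2M.
- move=> f hf; rewrite /V; apply: is_ratfun_P2D; first exact: is_ratfun_P2_pderiv.
  rewrite mulNr mulrAC; apply/is_ratfun_P2N/is_ratfun_P2M => //.
  exact: is_ratfun_P2_pderiv.
- exact: hX.
- rewrite (derivationM derV) VX2V mulr0 addr0.
  by rewrite /V !pderiv_X eqxx mulr0 mulr1 addr0 (divff (X_neq0 i2)).
- rewrite (derivationM der1) (derivationV der1) !pderiv_X.
  by rewrite !mul0r oppr0 mulr0 addr0.
- exact: leqnn.
- exact: hX.
- by rewrite mulrC (iter_derivationZ derV _ _ VX2V) Vp mulr0.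
- rewrite (derivationM der1) (derivationV der1) !pderiv_X.
  by rewrite !mul0r oppr0 mulr0 addr0 mul1r invr_eq0 X_neq0.
move=> f [hf Vf df].
have eulerf := euler_ratfun_P2 hf; rewrite big_ord3 in eulerf.
rewrite VE in Vf.
have [f0 f2] := tangent_and_euler (X_neq0 i2) O1 eulerO eulerf Vf.
apply: (has_rational_first_integralW (c := pderiv i1 f / Omega 0 i1) hf).
  apply/rowP; apply: ord3_ind; rewrite !mxE //.
  by rewrite (divfK O1).
by apply: contraNneq df => /rowP /(_ i1); rewrite !mxE => ->.
Qed.

End FirstIntegrals.

(** * First integrals of the foliations of the pencil *)

Section F4.
Variable k : fieldType.
Local Notation K := (ratfun3 k).
Local Notation X i := (('X_i : {mpoly k[3]})%:F).
Local Notation x := (X i0).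
Local Notation y := (X i1).
Local Notation z := (X i2).
Local Notation cst a := ((a%:MP_[3] : {mpoly k[3]})%:F).

Lemma pchar_ratfun p : p \in [pchar k] -> p \in [pchar K].
Proof.
move=> pchark.
have pcharP : p \in [pchar {mpoly k[3]}] by exact: (rmorph_pchar (@mpolyC 3 k)).
exact: (rmorph_pchar (@FracField.tofrac {mpoly k[3]})).
Qed.

Lemma F4_form_some (a : k) :
  [/\ F4_form (Some a) 0 i0 = (y ^+ 3 - z ^+ 3) * (y * z - cst a * x ^+ 2),
      F4_form (Some a) 0 i1 = (z ^+ 3 - x ^+ 3) * (x * z - cst a * y ^+ 2) &
      F4_form (Some a) 0 i2 = (x ^+ 3 - y ^+ 3) * (x * y - cst a * z ^+ 2)].
Proof.
by split; rewrite mxE /= -mul_mpolyC;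
  rewrite !(tofracB, tofracM, tofracXn).
Qed.

Lemma F4_form_none :
  [/\ F4_form (None : option k) 0 i0 = (y ^+ 3 - z ^+ 3) * x ^+ 2,
      F4_form (None : option k) 0 i1 = (z ^+ 3 - x ^+ 3) * y ^+ 2 &
      F4_form (None : option k) 0 i2 = (x ^+ 3 - y ^+ 3) * z ^+ 2].
Proof.
by split; rewrite mxE /= !(tofracB, tofracM, tofracXn).
Qed.

Lemma F4_form_euler (alpha : option k) :
  x * F4_form alpha 0 i0 + y * F4_form alpha 0 i1 + z * F4_form alpha 0 i2 = 0.
Proof.
rewrite !mxE -!tofracM -!tofracD -tofrac0; congr (_%:F).
exact: F4_coefs_euler.
Qed.

Lemma F4_form_some_neq0 (a : k) : F4_form (Some a) 0 i1 != 0.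
Proof.
have [_ -> _] := F4_form_some a.
rewrite mulf_neq0 ?subr_eq0 ?XX3_neq //.
(* Differentiating [x z = a y^2] with respect to [x] would give [z = 0]. *)
have d0 := pderiv_is_derivation k i0.
apply: contra_neq (X_neq0 k i2) => e.
have := congr1 (pderiv i0) e.
rewrite !(derivationM d0) !pderiv_X pderiv_C eqxx /= mul1r !mulr0 !mul0r.
by rewrite !addr0 mulr0 addr0.
Qed.

Lemma F4_form_ratio_P2 (a : k) :
  is_ratfun_P2 (F4_form (Some a) 0 i0 / F4_form (Some a) 0 i1).
Proof.
have hX := @mpolyX_homog k.
have h2 i j : ('X_i * 'X_j : {mpoly k[3]}) \is 2.-homog.
  exact: (dhomogM (hX i) (hX j)).
have hn n i : ('X_i ^+ n : {mpoly k[3]}) \is n.-homog.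
  by rewrite -[n in n.-homog]mul1n dhomogMn.
have := F4_form_some_neq0 a; rewrite !mxE tofrac_eq0 => D0.
apply: (@is_ratfun_P2_div _ (3 + 2)) D0.
  by apply: dhomogM; apply: rpredB; rewrite ?rpredZ ?hn ?h2.
by apply: dhomogM; apply: rpredB; rewrite ?rpredZ ?hn ?h2.
Qed.

Lemma lines_X_neq0 : lines x y z != 0.
Proof. by apply: lines_neq0; apply: XX3_neq. Qed.

Variable p : nat.
Hypothesis pchark : p \in [pchar k].
Hypothesis p_gt3 : (3 < p)%N.

Let pcharK : p \in [pchar K]. Proof. exact: pchar_ratfun. Qed.
Let p_prime : prime p. Proof. exact: pcharf_prime pchark. Qed.

Lemma F4_oo_has_first_integral :
  has_rational_first_integral (F4_form (None : option k)).
Proof.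
have [O0 O1 O2] := F4_form_none.
(* This is [1 + P / Q], and the form is a scalar multiple of [P dQ - Q dP]. *)
pose f : K := ('X_i0 ^+ 3 - 'X_i1 ^+ 3)%:F / ('X_i0 ^+ 3 - 'X_i2 ^+ 3)%:F.
pose c : K := 3%:R / (x ^+ 3 - z ^+ 3) ^+ 2.
have Q0 : x ^+ 3 - z ^+ 3 != 0 by rewrite subr_eq0 XX3_neq.
have fE : f = (x ^+ 3 - y ^+ 3) / (x ^+ 3 - z ^+ 3).
  by rewrite /f !(tofracB, tofracXn).
have c0 : c != 0.
  apply: mulf_neq0; last by rewrite invr_eq0; apply: expf_neq0.
  by rewrite -(dvdn_pcharf pcharK) gtnNdvd.
have df : differential f = c *: F4_form None.
  apply/rowP => i; rewrite mxE [RHS]mxE fE.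
  rewrite (derivation_cubes_ratio _ (pderiv_is_derivation k i) Q0).
  rewrite !pderiv_X /F4_oo; congr (_ * _); move: i; apply: ord3_ind => /=.
  - by rewrite O0 !mulr0 !addr0 mulr1.
  - by rewrite O1 !mulr0 addr0 add0r mulr1.
  by rewrite O2 !mulr0 !add0r mulr1.
apply: (has_rational_first_integralW (f := f) (c := c)) => //.
  have hX n i : ('X_i ^+ n : {mpoly k[3]}) \is n.-homog.
    by rewrite -[n in n.-homog]mul1n dhomogMn ?mpolyX_homog.
  apply: (@is_ratfun_P2_div _ 3); [by apply: rpredB | by apply: rpredB |].
  by move: Q0; rewrite -!tofracXn -tofracB tofrac_eq0.
have O1_neq0 : F4_form (None : option k) 0 i1 != 0.
  rewrite O1; apply: mulf_neq0; first by rewrite subr_eq0; apply: XX3_neq.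
  by apply: expf_neq0; apply: X_neq0.
rewrite df; apply: contra_neq c0 => /rowP/(_ i1); rewrite mxE [RHS]mxE => e.
by apply: (mulIf O1_neq0); rewrite mul0r.
Qed.

Section FiniteParameter.
Variables (n N j : nat) (a : k).
Hypothesis nNj : (p = 3 * n + 1 /\ N = 2 * n /\ j = n \/
                  p = 3 * n + 2 /\ N = n /\ j = n + 1)%N.
Let O i := F4_form (Some a) 0 i.

(** For [V] in the kernel of the form, the left-hand side of [iter_derivation_F4] is zero. *)
Lemma contraction_iter_F4 (V : K -> K) :
  is_derivation V -> (forall c : k, V (cst c) = 0) ->
  O i0 * V x + O i1 * V y + O i2 * V z = 0 ->
  lines x y z ^+ N * (O i0 * iter p V x + O i1 * iter p V y + O i2 * iter p V z) =
  'C(N, j)%:R *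
    (F4_0 x y z (V x) (V y) (V z) ^+ p
     - cst a * F4_oo x y z (V x) (V y) (V z) ^+ p).
Proof.
move=> derV Vc; rewrite /O; have [-> -> ->] := F4_form_some a.
rewrite -!F4_pencilE => OV.
have := iter_derivation_F4 pcharK x y z p_gt3 nNj derV (Vc a).
rewrite OV mulr0 (iter_derivation0 derV) => /eqP.
by rewrite eq_sym subr_eq0 => /eqP.
Qed.

(** As [V x = z] and [V z = 0], [iter p V] kills [x] and [z], so [contraction_iter_F4] isolates
    [iter p V y] with a nonzero coefficient. *)
Lemma F4_has_first_integral :
  'C(N, j)%:R = 0 :> K \/ a ^+ p = a ->
  has_rational_first_integral (F4_form (Some a)).
Proof.
move=> Ca; have O1 := F4_form_some_neq0 a.
apply: (first_integral_of_nilpotent pcharK O1).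
- exact: F4_form_ratio_P2.
- exact: F4_form_euler.
set V := fun f : K => _.
have derV : is_derivation V.
  by apply: is_derivation_comb; apply: pderiv_is_derivation.
have Vc (c : k) : V (cst c) = 0 by rewrite /V !pderiv_C !mulr0 addr0.
have Vx : V x = z by rewrite /V !pderiv_X eqxx mulr1 mulr0 addr0.
have Vz : V z = 0 by rewrite /V !pderiv_X !mulr0 addr0.
have Vy : V y = - (z * (O i0 / O i1)).
  by rewrite /V !pderiv_X eqxx mulr1 mulr0 add0r.
have OV : O i0 * V x + O i1 * V y + O i2 * V z = 0.
  rewrite Vx Vy Vz mulr0 addr0 mulrN [z * _]mulrC mulrA [O i1 * _]mulrC.
  by rewrite (divfK O1) subrr.
have := contraction_iter_F4 derV Vc OV.
have p2 : p = (p.-2).+2 by lia.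
have -> : iter p V x = 0 by rewrite p2 !iterSr Vx Vz (iter_derivation0 derV).
have -> : iter p V z = 0.
  by rewrite p2 !iterSr Vz (derivation0 derV) (iter_derivation0 derV).
rewrite !mulr0 addr0 add0r => H; apply/eqP; move: H.
(* Either the Hasse invariant is zero, or [a = a ^+ p] turns the bracket into the [p]-th power of
   the contraction of the form with [V], which is zero. *)
have -> : 'C(N, j)%:R * (F4_0 x y z (V x) (V y) (V z) ^+ p
    - cst a * F4_oo x y z (V x) (V y) (V z) ^+ p) = 0.
  case: Ca => [->|ap]; first by rewrite mul0r.
  have -> : cst a = cst a ^+ p by rewrite -tofracXn -rmorphXn /= ap.
  rewrite -exprMn -!(pFrobenius_autE pcharK) -rmorphB /= F4_pencilE.
  have [<- <- <-] := F4_form_some a.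
  by rewrite OV rmorph0 mulr0.
by move/eqP; rewrite !mulf_eq0 expf_eq0 (negPf lines_X_neq0) andbF (negPf O1).
Qed.

(** At [V], [contraction_iter_F4] gives [F4_0 ^+ p = a * F4_oo ^+ p], while [V] being in the kernel
    gives [F4_0 = a * F4_oo]; it remains to cancel [F4_oo ^+ p]. *)
Lemma F4_first_integral_frobenius_fixed :
  ~~ (p %| 'C(N, j))%N -> has_rational_first_integral (F4_form (Some a)) ->
  a ^+ p = a.
Proof.
move=> pC [f [_ df0 dfO]]; have O1 := F4_form_some_neq0 a.
have dE i : differential f 0 i = pderiv i f by rewrite mxE.
have wE (i l : 'I_3) : pderiv i f * O l = pderiv l f * O i.
  have /matrixP/(_ i l) := dfO; rewrite mxE [RHS]mxE !dE => /eqP.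
  by rewrite subr_eq0 => /eqP.
pose V (g : K) := O i1 * pderiv i0 g + (- O i0) * pderiv i1 g.
have derV : is_derivation V.
  by apply: is_derivation_comb; apply: pderiv_is_derivation.
have Vc (c : k) : V (cst c) = 0 by rewrite /V !pderiv_C !mulr0 addr0.
have Vx : V x = O i1 by rewrite /V !pderiv_X eqxx mulr1 mulr0 addr0.
have Vz : V z = 0 by rewrite /V !pderiv_X !mulr0 addr0.
have Vy : V y = - O i0 by rewrite /V !pderiv_X eqxx mulr1 mulr0 add0r.
have OV : O i0 * V x + O i1 * V y + O i2 * V z = 0.
  by rewrite Vx Vy Vz mulr0 addr0 mulrN [O i1 * _]mulrC subrr.
have Vf : V f = 0 by rewrite /V mulNr mulrC wE mulrC subrr.
(* The differential of [f] is proportional to a form with nonzero [dy] coefficient, so it would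
   vanish along with its own [dy] coefficient. *)
have f1 : pderiv i1 f != 0.
  apply: contra_neq df0 => f1; apply/rowP => i; rewrite !mxE.
  by apply: (mulIf O1); rewrite wE f1 !mul0r.
have derVp := iter_derivation_pchar pcharK derV.
have itc (c : k) : iter p V (cst c) = 0.
  by rewrite -(prednK (prime_gt0 p_prime)) iterSr Vc (iter_derivation0 derV).
have itf : iter p V f = 0.
  by rewrite -(prednK (prime_gt0 p_prime)) iterSr Vf (iter_derivation0 derV).
have OVp : O i0 * iter p V x + O i1 * iter p V y + O i2 * iter p V z = 0.
  apply: (proportional_annihilates f1 (wE i0 i1) (wE i2 i1)).
  by rewrite -[RHS]itf (ratfun_derivationE f derVp itc) big_ord3.
have := contraction_iter_F4 derV Vc OV; rewrite OVp mulr0 => /esym/eqP.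
rewrite mulf_eq0 -(dvdn_pcharf pcharK) (negPf pC) /= subr_eq0 => /eqP F0p.
have F0 : F4_0 x y z (V x) (V y) (V z) = cst a * F4_oo x y z (V x) (V y) (V z).
  apply/eqP; rewrite -subr_eq0 F4_pencilE.
  by have [<- <- <-] := F4_form_some a; rewrite OV.
have Foo : F4_oo x y z (V x) (V y) (V z) != 0.
  rewrite Vx Vy Vz /O; have [-> -> _] := F4_form_some a; rewrite F4_oo_tangent.
  by rewrite !mulf_neq0 ?X_neq0 ?subr_eq0 ?XX3_neq.
move: F0p; rewrite F0 exprMn => /(mulIf (expf_neq0 p Foo)).
rewrite -tofracXn -rmorphXn => /eqP; rewrite tofrac_eq => /eqP.
by move/(congr1 (mcoeff 0%MM)); rewrite !mcoeffC eqxx !mulr1.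
Qed.

End FiniteParameter.
End F4.

Theorem theorem1p5 (k : closedFieldType) (p : nat)
    (pchark : p \in [pchar k]) (p_gt3 : (3 < p)%N) :
  ((p = 2 %[mod 3])%N ->
     forall alpha : option k, has_rational_first_integral (F4_form alpha)) /\
  ((p = 1 %[mod 3])%N ->
     forall alpha : option k,
       has_rational_first_integral (F4_form alpha) <->
       match alpha with
       | Some a => in_prime_field p a
       | None => True
       end).
Proof.
have p_prime := pcharf_prime pchark; set n := (p %/ 3)%N.
have F4_oo_integral := F4_oo_has_first_integral pchark p_gt3.
split=> [p2 [a|] // | p1 [a|] //].
  (* Here [j = n + 1] exceeds [N = n], so the Hasse invariant ['C(N, j)] is zero. *)
  apply: (F4_has_first_integral (n := n) (N := n) (j := n.+1) pchark p_gt3).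
    by right; split; lia.
  by left; rewrite bin_small.
have nNj : (p = 3 * n + 1 /\ 2 * n = 2 * n /\ n = n \/
            p = 3 * n + 2 /\ 2 * n = n /\ n = n + 1)%N by left; split; lia.
rewrite -(frobenius_fixedP a pchark); split=> ap.
  apply: (F4_first_integral_frobenius_fixed pchark p_gt3 nNj) ap.
  by apply: prime_ndvd_central_bin => //; lia.
by apply: (F4_has_first_integral pchark p_gt3 nNj); right.
Qed.
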